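(* Assume the Axiom of Projective Determinacy (PD). Then every projective subset of $\mathbb{R}$ that is Menger (in the subspace topology) is $\sigma$-compact.
   Context: A space $X$ is Menger if, given any sequence $\{\mathcal{U}_n\}_{n<\omega}$ of open covers of $X$, there exist finite subsets $\mathcal{V}_n\subseteq\mathcal{U}_n$ such that $\bigcup_{n<\omega}\mathcal{V}_n$ covers $X$. PD is the assertion that for every projective set $A\subseteq\omega^\omega$ the infinite two-player perfect-information game on $\omega$ with payoff set $A$ is determined. The base theory is ZFC. *)

(* Defs.v *)
From HB Require Import structures.
From mathcomp Require Import all_boot all_order all_algebra.
From mathcomp Require Import boolp classical_sets functions cardinality reals.
From mathcomp Require Import topology normedtype.

Set Implicit Arguments.
Unset Strict Implicit.
Unset Printing Implicit Defensive.

Local Open Scope classical_set_scope.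

Definition baire : topologicalType := prod_topology (fun _ : nat => nat).

(* boldface Sigma^1_n for n >= 1: Sigma^1_1 sets are the projections along the
   Baire space of closed sets, and Sigma^1_{n+1} sets are the projections of
   Pi^1_n sets.  Level 0 (open sets) only serves to start the recursion.
   This is the usual projective hierarchy when X is Polish. *)
Fixpoint Sigma1 (n : nat) (X : topologicalType) : set (set X) :=
  if n is m.+1 then
    [set A | exists2 B : set (X * baire)%type,
       @Sigma1 m (X * baire)%type (~` B) & A = fst @` B]
  else open.

Definition projective (X : topologicalType) (A : set X) : Prop :=
  exists n, Sigma1 n.+1 A.

(* A play of the game is a point x of the Baire space; player I chooses
   x 0, x 2, ... and player II chooses x 1, x 3, ...  A strategy maps the
   finite sequence of all the moves made so far to the next move. *)
Definition strategy : Type := seq nat -> nat.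

Definition consistentI (s : strategy) (x : baire) : Prop :=
  forall k : nat, x k.*2 = s (mkseq x k.*2).

Definition consistentII (s : strategy) (x : baire) : Prop :=
  forall k : nat, x k.*2.+1 = s (mkseq x k.*2.+1).

Definition winningI (A : set baire) (s : strategy) : Prop :=
  forall x, consistentI s x -> A x.

Definition winningII (A : set baire) (s : strategy) : Prop :=
  forall x, consistentII s x -> ~ A x.

Definition determined (A : set baire) : Prop :=
  (exists s, winningI A s) \/ (exists s, winningII A s).

Definition PD : Prop := forall A : set baire, projective A -> determined A.

Definition open_cover (X : topologicalType) (U : set (set X)) : Prop :=
  U `<=` open /\ cover U id = setT.

Definition menger (X : topologicalType) : Prop :=
  forall U : nat -> set (set X), (forall n, open_cover (U n)) ->
  exists V : nat -> set (set X),
    (forall n, finite_set (V n) /\ V n `<=` U n) /\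
    cover (\bigcup_n V n) id = setT.

Definition sigma_compact (X : topologicalType) : Prop :=
  exists K : nat -> set X, (forall n, compact (K n)) /\ \bigcup_n K n = setT.

(* Main.v *)
(* Let c map the Cantor space continuously onto [-k, k], let Q be the set of
   eventually zero points, and play the Wadge game for c^-1(A) and Q. A winning
   strategy for player I exhibits c^-1(A) as a continuous preimage of the
   sigma-compact set Q, so that A meets [-k, k] in a sigma-compact set. A winning
   strategy for player II yields a continuous f from the Cantor space to R with
   f^-1(A) the complement of Q. Then A is not Menger: if F n m is the compact set
   of the points with at most n ones among the first m digits, the sets A \ f(F n m)
   (m = 0, 1, ...) increase to A for every n, but whatever m_n is selected for each
   n, some x outside Q lies in every F n m_n, and f x is left uncovered. *)

Require Import Defs.
From HB Require Import structures.
From mathcomp Require Import all_boot all_order all_algebra.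
From mathcomp Require Import boolp classical_sets functions cardinality reals.
From mathcomp Require Import topology normedtype cantor.
Import numFieldNormedType.Exports.

Set Implicit Arguments.
Unset Strict Implicit.
Unset Printing Implicit Defensive.

Import Order.TTheory Num.Theory.

Local Open Scope classical_set_scope.

(** * Continuity of maps into products and out of discrete spaces *)

Lemma continuous_prod (I : Type) (T : I -> topologicalType)
    (X : topologicalType) (f : X -> prod_topology T) :
  (forall i, continuous (fun x => f x i)) -> continuous f.
Proof.
move=> fc x; apply/cvg_sup => i U [_ [[V oV <-] Vx]] VU.
apply: filterS VU _; apply: (fc i x); exact: open_nbhs_nbhs.
Qed.

Lemma continuous_pair (X Y Z : topologicalType) (f : X -> Y) (g : X -> Z) :
  continuous f -> continuous g -> continuous (fun x => (f x, g x)).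
Proof. by move=> fc gc x; apply: cvg_pair; [apply: fc|apply: gc]. Qed.

Lemma continuous_compT (X Y Z : topologicalType) (f : X -> Y) (g : Y -> Z) :
  continuous f -> continuous g -> continuous (g \o f).
Proof. by move=> fc gc x; apply: continuous_comp; [apply: fc|apply: gc]. Qed.

Lemma coord_continuous (I : eqType) (T : I -> topologicalType) (i : I) :
  continuous (fun x : prod_topology T => x i).
Proof. exact: proj_continuous. Qed.

Lemma discrete_continuous (T : discreteTopologicalType) (Y : topologicalType)
  (f : T -> Y) : continuous f.
Proof. by apply/continuousP => U _; exact: discrete_open. Qed.

(** * Closure properties of the projective hierarchy *)

Lemma Sigma1_preimage n (X Y : topologicalType) (f : X -> Y) (A : set Y) :
  continuous f -> Sigma1 n A -> Sigma1 n (f @^-1` A).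
Proof.
elim: n X Y f A => [|n IHn] X Y f A fc /=.
  by move: fc => /continuousP; apply.
case=> B SB ->; exists ((fun p => (f p.1, p.2)) @^-1` B).
  rewrite preimage_setC; apply: IHn SB; apply: continuous_pair.
    apply: (continuous_compT (f := fst) (g := f)) => // x; exact: cvg_fst.
  by move=> x; exact: cvg_snd.
apply/seteqP; split => [x [[y z] Byz /= yx]|x [[x' z] /= Bz <-]].
  by exists (x, z) => //=; rewrite -yx.
by exists (f x', z).
Qed.

(** The complement is the projection of the cylinder over it, with a dummy witness in the Baire
    space. *)
Lemma Sigma1_setC n (X : topologicalType) (A : set X) :
  Sigma1 n A -> Sigma1 n.+1 (~` A).
Proof.
move=> SA; exists (fst @^-1` (~` A)).
  rewrite preimage_setC setCK; apply: Sigma1_preimage SA.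
  by move=> x; exact: cvg_fst.
apply/seteqP; split => [x nAx|x [[x' z] /= nA <-]] //.
by exists (x, (fun=> 0%N) : baire).
Qed.

(** Both closures are proved together because complementation swaps them at each level. For an
    intersection, the two Baire witnesses are merged into one, on its even and odd coordinates. *)
Lemma Sigma1_setUI n (X : topologicalType) (A B : set X) :
  Sigma1 n A -> Sigma1 n B -> Sigma1 n (A `|` B) /\ Sigma1 n (A `&` B).
Proof.
elim: n X A B => [|n IHn] X A B /=.
  by move=> oA oB; split; [exact: openU|exact: openI].
move=> [C SC ->] [D SD ->]; split.
  by exists (C `|` D); [rewrite setCU; exact: (IHn _ _ _ SC SD).2|
                        rewrite image_setU].
pose half (b : bool) (p : X * baire) : X * baire :=
  (p.1, (fun k => p.2 (b + k.*2)%N) : baire).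
have half_cont b : continuous (half b).
  apply: continuous_pair; first by move=> x; exact: cvg_fst.
  apply: continuous_prod => k.
  apply: (continuous_compT (f := snd) (g := fun y : baire => y (b + k.*2)%N)).
    by move=> x; exact: cvg_snd.
  exact: coord_continuous.
exists (half false @^-1` C `&` half true @^-1` D).
  rewrite setCI (preimage_setC (half false)) (preimage_setC (half true)).
  by apply: (IHn _ _ _ _ _).1; exact: Sigma1_preimage.
apply/seteqP; split => [x [[[x1 y] Cy <-] [[x2 z] Dz /= x21]]|].
  rewrite {}x21 in Dz.
  pose m : baire := fun k => if odd k then z k./2 else y k./2.
  exists (x1, m) => //; split.
    rewrite [X in C X](_ : _ = (x1, y)) //; congr pair; apply/funext => k.
    by rewrite /m /= add0n odd_double doubleK.
  rewrite [X in D X](_ : _ = (x1, z)) //; congr pair; apply/funext => k.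
  by rewrite /m /= odd_double /= uphalf_double.
by move=> x [[x' y] [/= Cy Dy] <-]; split; [exists (half false (x', y))|
  exists (half true (x', y))].
Qed.

(* [E n x] stands for the ball of radius 2^-n around [x] in an ultrametric. *)
Definition graded (X : topologicalType) : Prop :=
  exists E : nat -> X -> set X,
  [/\ forall n x, E n x x,
      forall n x y, E n x y -> E n y = E n x,
      forall n x, open (E n x),
      forall x U, nbhs x U -> exists n, E n x `<=` U &
      forall m n x, (m <= n)%N -> E n x `<=` E m x].

Lemma graded_baire : graded baire.
Proof.
exists (fun n x => [set y : baire | forall i, (i < n)%N -> y i = x i]); split.
- by [].
- move=> n x y xy; apply/seteqP.
  by split=> z H i lin; rewrite H // xy.
- move=> n x; elim: n => [|n IHn].
    rewrite [X in open X](_ : _ = setT); first exact: openT.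
    by apply/seteqP; split.
  rewrite [X in open X](_ : _ =
    [set y : baire | forall i, (i < n)%N -> y i = x i] `&`
    ((fun y : baire => y n) @^-1` [set x n])).
    apply: openI => //.
    have /continuousP := @coord_continuous _ (fun=> nat) n.
    by apply; exact: discrete_open.
  apply/seteqP; split => y /=.
    by move=> H; split; [move=> i lin; apply: H; exact: leqW|apply: H].
  by case=> H Hn i; rewrite ltnS leq_eqVlt => /predU1P[->//|]; exact: H.
(* If no ball around [x] fits into [U], pick [y n] in the [n]-th ball outside [U]. Coordinate [i] of
   [y n] agrees with that of [x] once [n > i], so [y] converges to [x]. *)
- move=> x U xU; apply: contrapT => /forallNP nU.
  have {}nU n : exists y : baire, (forall i, (i < n)%N -> y i = x i) /\ ~ U y.
    by have /existsNP[y /not_implyP[]] := nU n; exists y.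
  have [y yP] := choice nU.
  have /(_ _ xU) [n _ /(_ n (leqnn n)) yU] : y @ \oo --> x.
    apply/cvg_sup => i V [_ [[W oW <-] Wx] WV].
    by exists i.+1 => // n /= ilen; apply: WV; rewrite /= (yP n).1.
  exact: (yP n).2.
- by move=> m n x mn y yx i lim; apply: yx; exact: leq_trans mn.
Qed.

Lemma graded_prod (X Y : topologicalType) :
  graded X -> graded Y -> graded (X * Y)%type.
Proof.
move=> [E [E1 E2 E3 E4 E5]] [F [F1 F2 F3 F4 F5]].
exists (fun n x => E n x.1 `*` F n x.2); split.
- by move=> n x; split.
- by move=> n x y [Ey Fy]; rewrite (E2 _ _ _ Ey) (F2 _ _ _ Fy).
- move=> n x; rewrite [X in open X](_ : _ =
    (fst @^-1` E n x.1) `&` (snd @^-1` F n x.2)) //.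
  apply: openI.
    have /continuousP : continuous (@fst X Y) by move=> ?; exact: cvg_fst.
    by apply; exact: E3.
  have /continuousP : continuous (@snd X Y) by move=> ?; exact: cvg_snd.
  by apply; exact: F3.
- move=> x U [[V W] /= [xV xW] VWU].
  have [m mV] := E4 _ _ xV; have [n nW] := F4 _ _ xW.
  exists (maxn m n) => -[y z] [/= Ey Fz]; apply: VWU; split => /=.
    by apply: mV; apply: E5 Ey; exact: leq_maxl.
  by apply: nW; apply: F5 Fz; exact: leq_maxr.
- by move=> m n x mn y [Ey Fy]; split; [exact: E5 Ey|exact: F5 Fy].
Qed.

(** The first coordinate of the Baire witness names the index [n]. *)
Lemma Fsigma_Sigma1 (X : topologicalType) (F : nat -> set X) :
  (forall n, closed (F n)) -> Sigma1 1 (\bigcup_n F n).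
Proof.
move=> cF; exists [set p | F (p.2 0%N) p.1]; last first.
  apply/seteqP; split => [x [n _ Fx]|x [[x' y] /= Fy <-]].
    by exists (x, (fun=> n) : baire).
  by exists (y 0%N).
rewrite /= [X in open X](_ : _ = \bigcup_n ((fst @^-1` (~` F n)) `&`
   (snd @^-1` ((fun y : baire => y 0%N) @^-1` [set n])))).
  apply: bigcup_open => n _; apply: openI.
    have /continuousP : continuous (@fst X baire) by move=> ?; exact: cvg_fst.
    by apply; exact: closed_openC.
  have /continuousP : continuous (@snd X baire) by move=> ?; exact: cvg_snd.
  apply; have /continuousP := @coord_continuous _ (fun=> nat) 0%N.
  by apply; exact: discrete_open.
apply/seteqP; split => [[x y] /= nF|[x y] [n _ [/= nF ->]]] //.
by exists (y 0%N).
Qed.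

(** Open sets are F-sigma here: the points whose [n]-th ball lies in [A] form a closed set, since
    the complement is a union of [n]-th balls. *)
Lemma graded_open_Sigma1 (X : topologicalType) (A : set X) :
  graded X -> open A -> Sigma1 1 A.
Proof.
move=> [E [E1 E2 E3 E4 E5]] oA.
rewrite (_ : A = \bigcup_n [set x | E n x `<=` A]); last first.
  apply/seteqP; split => [x Ax|x [n _]]; last by apply; exact: E1.
  by have [n nA] := E4 x A (open_nbhs_nbhs (conj oA Ax)); exists n.
apply: Fsigma_Sigma1 => n; rewrite -[X in closed X]setCK.
apply: open_closedC; rewrite [X in open X](_ : _ =
   \bigcup_(x in [set x | ~ E n x `<=` A]) E n x).
  by apply: bigcup_open => x _; exact: E3.
apply/seteqP; split => [x nx|y [x /= nx xy] yA]; first by exists x.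
by apply: nx; rewrite -(E2 _ _ _ xy).
Qed.

Lemma Sigma1_S n (X : topologicalType) (A : set X) :
  graded X -> Sigma1 n A -> Sigma1 n.+1 A.
Proof.
elim: n X A => [|n IHn] X A gX; first exact: graded_open_Sigma1.
case=> B SB ->; exists B => //; apply: IHn SB.
by apply: graded_prod => //; exact: graded_baire.
Qed.

Lemma Sigma1_le m n (X : topologicalType) (A : set X) :
  graded X -> (m <= n)%N -> Sigma1 m A -> Sigma1 n A.
Proof.
move=> gX /subnK <- SA; elim: (n - m)%N => [//|k IHk].
by rewrite addSn; exact: Sigma1_S.
Qed.

(** This makes the payoff set of the Wadge game projective. The common level leaves room for
    complements, which cost one level. *)
Lemma projective_iff (X : topologicalType) (A B : set X) :
  graded X -> projective A -> projective B ->
  projective [set x | A x <-> B x].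
Proof.
move=> gX [m SA] [n SB]; pose k := (maxn m n).+1.
have {}SA : Sigma1 k A by apply: Sigma1_le SA; rewrite ?ltnS ?leq_maxl.
have {}SB : Sigma1 k B by apply: Sigma1_le SB; rewrite ?ltnS ?leq_maxr.
exists k; rewrite (_ : [set _ | _] = (A `&` B) `|` (~` A `&` ~` B)).
  apply: (Sigma1_setUI _ _).1; apply: (Sigma1_setUI _ _).2;
    by [exact: Sigma1_S|exact: Sigma1_setC].
apply/seteqP; split => x /=; last by move=> [[]|[]].
by have [Ax|nAx] := pselect (A x) => AB; [left; tauto|right; tauto].
Qed.

(** * Strategies as continuous maps, and the Wadge game *)

Fixpoint position (step : seq nat -> nat) (n : nat) : seq nat :=
  if n is m.+1 then rcons (position step m) (step (position step m)) else [::].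

(* The play in which the player moving at the turns of parity [b] plays the
   bits of [z] while the opponent follows the strategy [s]. *)
Definition versus (b : bool) (s : strategy) (z : cantor_space) : baire :=
  fun n => let step l := if odd (size l) == b then nat_of_bool (z (size l)./2)
                         else s l in
  step (position step n).

Lemma size_position step n : size (position step n) = n.
Proof. by elim: n => //= n IHn; rewrite size_rcons IHn. Qed.

Lemma positionE step n :
  position step n = mkseq (fun k => step (position step k)) n.
Proof. by elim: n => // n IHn; rewrite mkseqS -IHn. Qed.

Lemma versusE b s z n :
  versus b s z n = if odd n == b then nat_of_bool (z n./2)
                   else s (mkseq (versus b s z) n).
Proof. by rewrite {1}/versus size_position positionE. Qed.

Lemma versus_consistentI s z : consistentI s (versus true s z).
Proof. by move=> k; rewrite versusE odd_double. Qed.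

Lemma versus_consistentII s z : consistentII s (versus false s z).
Proof. by move=> k; rewrite versusE /= odd_double. Qed.

Lemma versus_continuous b s : continuous (versus b s).
Proof.
apply: continuous_prod => n z U zU.
(* Near [z] the first [n.+1] moves do not change: each is determined by the earlier moves and at
   most one bit of [z]. *)
suff: \forall z' \near z,
    mkseq (versus b s z') n.+1 = mkseq (versus b s z) n.+1.
  apply: filterS => z' e.
  rewrite /= -[versus b s z' n](nth_mkseq 0%N _ (ltnSn n)).
  by rewrite e nth_mkseq //; exact: nbhs_singleton.
elim: n.+1 => [|m IHm]; first exact: filterE (fun=> erefl).
have zm : \forall z' \near z, z' m./2 = z m./2.
  have /(_ z [set z m./2]) := @coord_continuous _ (fun=> bool) m./2.
  by apply; exact: discrete_set1.
near=> z'; rewrite !mkseqS.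
have -> : mkseq (versus b s z') m = mkseq (versus b s z) m by near: z'.
have e : z' m./2 = z m./2 by near: z'.
congr rcons; rewrite !versusE e.
by have -> : mkseq (versus b s z') m = mkseq (versus b s z) m by near: z'.
Unshelve. all: by end_near. Qed.

(** The moves of player I ([b = false]) or II ([b = true]) are read as bits, zero against nonzero,
    so that every natural number is a legal move. *)
Definition bits (b : bool) (w : baire) : cantor_space :=
  fun k => w (b + k.*2)%N != 0%N.

Lemma bits_continuous b : continuous (bits b).
Proof.
apply: continuous_prod => k.
apply: (continuous_compT (f := fun w : baire => w (b + k.*2)%N)
  (g := fun m => m != 0%N)); first exact: coord_continuous.
exact: discrete_continuous.
Qed.

Lemma bits_versus b s z : bits b (versus b s z) = z.
Proof.
apply/funext => k; rewrite /bits versusE.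
rewrite oddD odd_double addbF oddb eqxx halfD oddb odd_double andbF.
by case: b; rewrite /= ?add0n doubleK; case: (z k).
Qed.

(** Player I builds a point [x], player II a point [y], and I wins when [B x <-> A y]. Feeding an
    arbitrary point to a winning strategy as the opponent's moves gives the map [g]. *)
Lemma wadge (pd : PD) (A B : set cantor_space) :
  projective A -> projective B ->
  (exists2 g : cantor_space -> cantor_space, continuous g & A = g @^-1` B) \/
  (exists2 g : cantor_space -> cantor_space, continuous g & B = g @^-1` (~` A)).
Proof.
move=> pA pB.
have pb b C : projective C -> projective (bits b @^-1` C).
  by case=> n SC; exists n; apply: Sigma1_preimage SC; exact: bits_continuous.
have [[s Is]|[s IIs]] :=
  pd _ (projective_iff graded_baire (pb false _ pB) (pb true _ pA)).
- left; exists (bits false \o versus true s).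
    apply: continuous_compT; [exact: versus_continuous|exact: bits_continuous].
  apply/seteqP; split => z; have := Is _ (versus_consistentI s z);
    by rewrite /= bits_versus => -[].
- right; exists (bits true \o versus false s).
    apply: continuous_compT; [exact: versus_continuous|exact: bits_continuous].
  apply/seteqP; split => x; have := IIs _ (versus_consistentII s x);
    rewrite /= bits_versus; first by move=> H Bx Ax; apply: H.
  by move=> H nAx; apply: contrapT => nBx; apply: H.
Qed.

(** * Eventually zero points and counting ones in the Cantor space *)

Definition eventually0_from (m : nat) : set cantor_space :=
  [set x | forall k, (m <= k)%N -> x k = false].

Definition eventually0 : set cantor_space :=
  [set x | exists m, eventually0_from m x].

Lemma closed_eventually0_from m : closed (eventually0_from m).
Proof.
rewrite (_ : eventually0_from m =
  \bigcap_(k in [set k | (m <= k)%N])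
    ((fun x : cantor_space => x k) @^-1` [set false])) //.
apply: closed_bigI => k _.
have /continuous_closedP := @coord_continuous _ (fun=> bool) k.
by apply; exact: discrete_closed.
Qed.

Lemma eventually0E : eventually0 = \bigcup_m eventually0_from m.
Proof. by apply/seteqP; split => x [m]; [exists m|move=> _; exists m]. Qed.

Lemma projective_eventually0 : projective eventually0.
Proof.
exists 0%N; rewrite eventually0E.
by apply: Fsigma_Sigma1 => m; exact: closed_eventually0_from.
Qed.

Definition few_ones (n m : nat) : set cantor_space :=
  [set x | (count x (iota 0 m) <= n)%N].

Lemma closed_few_ones n m : closed (few_ones n m).
Proof.
rewrite -[few_ones n m]setCK; apply: open_closedC; rewrite openE => x nx.
suff: \forall y \near x, count y (iota 0 m) = count x (iota 0 m).
  by apply: filterS => y e; rewrite /few_ones /= e.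
elim: m {nx} => [|m IHm]; first exact: filterE (fun=> erefl).
have xm : \forall y \near x, y m = x m.
  have /(_ x [set x m]) := @coord_continuous _ (fun=> bool) m.
  by apply; exact: discrete_set1.
near=> y; rewrite -addn1 iotaD !count_cat /= add0n.
have -> : y m = x m by near: y.
by congr addn; near: y.
Unshelve. all: by end_near. Qed.

(** Otherwise there is a one beyond every position, and the counts of ones on initial segments
    exceed [n]. *)
Lemma few_ones_eventually0 n x :
  (forall m, few_ones n m x) -> eventually0 x.
Proof.
move=> few; apply: contrapT => nx.
suff [m] : exists m, (n < count x (iota 0 m))%N by rewrite ltnNge few.
elim: n.+1 => {few} [|j [m jm]]; first by exists 0%N.
have /existsNP[k /not_implyP[mk /eqP]] :
    ~ forall k, (m <= k)%N -> x k = false.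
  by move=> H; apply: nx; exists m.
rewrite eqbF_neg negbK => xk.
exists k.+1; rewrite -[k.+1]addn1 iotaD add0n count_cat /= xk addn1 ltnS.
by rewrite -(subnKC mk) iotaD count_cat; exact: leq_trans (leq_addr _ _).
Qed.

Lemma subset_few_ones n m k : (m <= k)%N -> few_ones n k `<=` few_ones n m.
Proof.
move=> mk x; rewrite /few_ones /= -(subnKC mk) iotaD count_cat.
by apply: leq_trans; exact: leq_addr.
Qed.

(** This diagonal point defeats any finite selections from the covers. The successors in the sum
    make [P] strictly increasing, so the witness has infinitely many ones. *)
Lemma exists_few_ones (M : nat -> nat) :
  exists2 x, ~ eventually0 x & forall n, few_ones n (M n) x.
Proof.
(* The ones of the witness are put at the positions [P n >= M n]. *)
pose P n := (\sum_(i < n.+1) (M i).+1)%N.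
have PS n : (P n < P n.+1)%N by rewrite /P [ltnRHS]big_ord_recr /= addnS ltnS leq_addr.
have Pmono : {homo P : i j / (i <= j)%N}.
  by apply: homo_leq => // [? ? ?|n]; [exact: leq_trans|exact: ltnW].
have nP n : (n <= P n)%N by elim: n => // n IHn; exact: leq_ltn_trans (PS n).
have MP n : (M n <= P n)%N.
  by rewrite /P big_ord_recr /= addnS; apply: leqW; exact: leq_addl.
exists (fun k => `[< exists i, P i = k >]).
  by move=> [m /(_ _ (nP m))/negbT/negP]; apply; apply/asboolP; exists m.
move=> n; rewrite /few_ones /= -size_filter.
(* A one below [M n] sits at some [P i] with [i < n], since [P i >= P n >= M n] for the other
   [i]. *)
apply: (@leq_trans (size (map P (iota 0 n)))); last first.
  by rewrite size_map size_iota.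
apply: uniq_leq_size; first exact/filter_uniq/iota_uniq.
move=> k; rewrite mem_filter mem_iota add0n => /andP[/asboolP[i <-] /= PiM].
apply: map_f; rewrite mem_iota add0n /= ltnNge; apply/negP => /Pmono ni.
by have := leq_trans PiM (leq_trans (MP n) ni); rewrite ltnn.
Qed.

(** * Subspaces and the failure of the Menger property *)

(** A cluster point of the image filter lies in [C], hence in [A], and the open sets of [A] are
    traces of open sets of [X]. *)
Lemma compact_set_type (X : topologicalType) (A C : set X) :
  compact C -> C `<=` A -> compact (set_val @^-1` C : set (set_type A)).
Proof.
move=> cC CA F PF FC.
have [p [Cp clp]] := cC (set_val @ F) _ FC.
exists (SigSub (mem_set (CA _ Cp))); split => // U V FU [_ [[W oW <-] /= Wp] WV].
have FU' : F (set_val @^-1` (set_val @` U)) by apply: (filterS _ FU) => a Ua; exists a.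
have [_ [[a Ua <-] Wa]] := clp _ W FU' (open_nbhs_nbhs (conj oW Wp)).
by exists a; split => //; exact: WV.
Qed.

Lemma hausdorff_set_type (X : topologicalType) (A : set X) :
  hausdorff_space X -> hausdorff_space (set_type A).
Proof.
move=> hX p q clpq; apply: val_inj; apply: hX => U V Up Vq.
have vc := @initial_continuous (set_type A) X set_val.
have [a [Ua Va]] := clpq _ _ (vc p U Up) (vc q V Vq).
by exists (set_val a).
Qed.

Lemma menger_preimage_neq (X : topologicalType) (A : set X) (f : cantor_space -> X) :
  hausdorff_space X -> menger (set_type A) -> continuous f ->
  eventually0 <> f @^-1` (~` A).
Proof.
move=> hX mA fc fA.
pose D n m := f @` few_ones n m.
have cD n m : compact (D n m).
  apply: continuous_compact; first exact: continuous_subspaceT.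
  apply: subclosed_compact cantor_space_compact _; first exact: closed_few_ones.
  exact: subsetT.
pose O n m : set (set_type A) := set_val @^-1` (~` D n m).
have subO n m k : (m <= k)%N -> O n m `<=` O n k.
  move=> mk a nDa [x xk xa]; apply: nDa; exists x => //.
  exact: subset_few_ones mk _ _.
have OT n : open_cover (range (O n)).
  split.
    move=> _ [m _ <-].
    have /continuousP := @initial_continuous (set_type A) X set_val.
    by apply; apply: closed_openC; exact: compact_closed.
  apply/seteqP; split => // a _; apply: contrapT => na.
  (* A point [a] left uncovered has a preimage in every [few_ones n m]. A cluster point [p] of these
     preimages has at most [n] ones and [f p = a], so [p] is eventually zero although [f p] is in
     [A]. *)
  have xP m : exists x, few_ones n m x /\ f x = set_val a.
    apply: contrapT => H; apply: na; exists (O n m); first by exists m.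
    by move=> [x xm xa]; apply: H; exists x.
  have [x {}xP] := choice xP.
  have [p [_ clp]] := @cantor_space_compact (x @ \oo) _ filterT.
  (* A closed set containing a tail of the sequence contains its cluster point. *)
  have cl (C : set cantor_space) m :
      closed C -> (forall k, (m <= k)%N -> C (x k)) -> C p.
    move=> cC xC; rewrite (closure_id C).1//; move: clp.
    by rewrite clusterE; apply; exists m.
  have p0 : eventually0 p.
    apply: (@few_ones_eventually0 n) => m; apply: (cl _ m).
      exact: closed_few_ones.
    by move=> k mk; apply: subset_few_ones mk _ (xP k).1.
  suff pa : f p = set_val a by rewrite fA /= pa in p0; exact: p0 (set_valP a).
  have := cl (f @^-1` [set set_val a]) 0%N; apply.
    have /continuous_closedP := fc; apply; apply: accessible_closed_set1.
    exact: hausdorff_accessible.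
  by move=> k _; exact: (xP k).2.
have [V [Vfin VT]] := mA _ OT.
(* The sets [O n m] increase with [m], so a finite selection lies inside a single one. *)
have MP n : exists M, forall W, V n W -> W `<=` O n M.
  have [/finite_seqP[s Vs] VO] := Vfin n.
  have {VO}sO W : W \in s -> range (O n) W by move=> Ws; apply: VO; rewrite Vs.
  suff [M MP] : exists M, forall W, W \in s -> W `<=` O n M.
    by exists M => W; rewrite Vs; exact: MP.
  elim: s sO {Vs} => [|W s IHs] sO; first by exists 0%N.
  have [|M MP] := IHs; first by move=> W' Ws; apply: sO; rewrite inE Ws orbT.
  have [m _ mW] := sO W (mem_head _ _).
  exists (maxn m M) => W'; rewrite inE => /predU1P[->|/MP W'M].
    by rewrite -mW; apply: subO; exact: leq_maxl.
  by apply: subset_trans W'M _; apply: subO; exact: leq_maxr.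
have [M {}MP] := choice MP.
have [x nx xM] := exists_few_ones M.
have Ax : A (f x) by apply: contrapT => nA; apply: nx; rewrite fA.
have : cover (\bigcup_n V n) id (SigSub (mem_set Ax) : set_type A) by rewrite VT.
by case=> W [n _ VW] Wx; apply: (MP n W VW _ Wx); exists x.
Qed.

(** * From the Cantor space to the real line *)

Local Open Scope ring_scope.

(** The interval gets a type of its own so that it can carry a base point, zero. *)
Definition symitv (R : realType) (k : nat) : Type := set_type `[- k%:R : R, k%:R]%classic.

Fact symitv0 (R : realType) (k : nat) : (0 : R) \in `[- k%:R, k%:R]%classic.
Proof. by rewrite inE /= in_itv /= oppr_le0 ler0n. Qed.

HB.instance Definition _ R k := PseudoMetric.on (symitv R k).
HB.instance Definition _ R k :=
  isPointed.Build (symitv R k) (SigSub (symitv0 R k)).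

(** A nonempty compact metric space is a continuous image of the Cantor space. *)
Lemma cantor_symitv (R : realType) (k : nat) : exists2 c : cantor_space -> R,
  continuous c & range c = `[- k%:R, k%:R]%classic.
Proof.
have [||c cc] := @cantor_surj R (symitv R k).
- have := compact_set_type (@segment_compact R (- k%:R) k%:R) (@subset_refl _ _).
  by congr compact; apply/seteqP; split => // a _; exact: set_valP.
- exact: hausdorff_set_type (@Rhausdorff R).
exists (set_val \o c).
  apply: continuous_compT cc _; exact: initial_continuous.
apply/seteqP; split => [_ [z _ <-]|x xk]; first exact: set_valP.
have [z _ zx] := 'surj_c (I : setT (SigSub (mem_set xk) : symitv R k)).
by exists z => //=; rewrite zx.
Qed.

(* set_type A carries the subspace topology induced by R. *)
Theorem theorem1p7 (R : realType) (pd : PD) (A : set R) (projA : projective A)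
    (mengerA : menger (set_type A)) :
  sigma_compact (set_type A).
Proof.
have /choice[K KP] : forall k : nat, exists K : nat -> set R,
    (forall m, compact (K m)) /\ \bigcup_m K m = A `&` `[- k%:R, k%:R]%classic.
  move=> k; have [c cc ck] := cantor_symitv R k.
  have pA : projective (c @^-1` A).
    by case: projA => n SA; exists n; exact: Sigma1_preimage SA.
  have [[g gc gA]|[g gc gA]] := wadge pd pA projective_eventually0; last first.
    by have := menger_preimage_neq (@Rhausdorff R) mengerA (continuous_compT gc cc).
  exists (fun m => c @` (g @^-1` eventually0_from m)); split.
    move=> m; apply: continuous_compact; first exact: continuous_subspaceT.
    apply: subclosed_compact cantor_space_compact _; last exact: subsetT.
    have /continuous_closedP := gc; apply; exact: closed_eventually0_from.
  rewrite -image_bigcup -preimage_bigcup -eventually0E -gA -ck.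
  apply/seteqP; split => [_ [z Az <-]|_ [/[swap] -[z _ <-] Az]]; last by exists z.
  by split => //; exists z.
(* The doubly indexed compact sets are enumerated through codes of pairs; a number that codes no
   pair yields the empty set. *)
pose L n := if unpickle n is Some (k, m) then K k m else set0.
have LA n : L n `<=` A.
  rewrite /L; case: unpickle => [[k m]|] // x Kx.
  by have [] : (A `&` `[- k%:R, k%:R]%classic) x by rewrite -(KP k).2; exists m.
exists (fun n => set_val @^-1` L n); split.
  move=> n; apply: compact_set_type (LA n).
  by rewrite /L; case: unpickle => [[k m]|]; [exact: (KP k).1|exact: compact0].
apply/seteqP; split => // a _.
have [k ak] : exists k : nat, `|set_val a| <= k%:R.
  exists (Num.truncn `|set_val a|).+1; exact: ltW (truncnS_gt _).
have : (A `&` `[- k%:R, k%:R]%classic) (set_val a).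
  by split; [exact: set_valP|rewrite /= in_itv /= -ler_norml].
rewrite -(KP k).2 => -[m _ Ka]; exists (pickle (k, m)) => //.
by rewrite /= /L pickleK.
Qed.
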